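(* Let $\lambda,\mu,\nu$ be partitions of $l$, $m$, $l+m$ respectively. Let $(x_1,x_2)$, $(y_1,y_2)$, $(w_1,w_2)$ be complementary pairs of words (of lengths $l$, $m$, $l+m$) corresponding to $\lambda,\mu,\nu$ respectively. Let $L$ be the Littlewood-Richardson matrix: its rows are indexed by triples $(p,q,r)$ where $p,q,r$ are rearrangements of $x_1,y_1,w_1$ respectively, its columns are indexed by triples $(s,t,u)$ where $s,t,u$ are rearrangements of $x_2,y_2,w_2$ respectively, and its $((p,q,r),(s,t,u))$ entry is $$\sum_{\sigma\times\tau\in S_l\times S_m}\mathrm{Y}_{x_2,x_1}(\sigma s,p)\cdot\mathrm{Y}_{y_2,y_1}(\tau t,q)\cdot\mathrm{Y}_{w_2,w_1}((\sigma\times\tau)u,r).$$ Then the dimension of the Littlewood-Richardson polytope, i.e. the convex hull of the columns of $L$ in the real vector space with coordinates indexed by the rows of $L$, equals the Littlewood-Richardson coefficient $$c_{\lambda\mu}^{\nu}=\dim\,\bigl((V(\lambda)\boxtimes V(\mu))\otimes \mathrm{Res}^{S_{l+m}}_{S_l\times S_m}V(\nu)\bigr)^{S_l\times S_m}.$$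
   Context: A word of length $n$ is a sequence of $n$ letters; $S_n$ acts on words of length $n$ by permuting positions, $(\sigma w)_i=w_{\sigma^{-1}(i)}$. A rearrangement of $w$ is an element of its $S_n$-orbit. Words $w_1,w_2$ of the same length $n$ have complementary rearrangements if the diagonal action of $S_n$ on $\{\text{rearrangements of }w_1\}\times\{\text{rearrangements of }w_2\}$ has exactly one free orbit (an orbit whose points have trivial stabilizer); they are complementary if moreover $(w_1,w_2)$ lies in that free orbit. A complementary pair $(w_1,w_2)$ corresponds to the partition $\lambda$ of $n$ if, for every $j\ge1$, the $j$-th most common letter of $w_1$ occurs $\lambda_j$ times in $w_1$ and the $j$-th most common letter of $w_2$ occurs $\lambda^*_j$ times in $w_2$, where $\lambda^*_j=\#\{k:\lambda_k\ge j\}$ is the conjugate partition. Such a pair exists for every $\lambda$. Young's character: for words $a,b$ of length $n$ and rearrangements $r$ of $a$ and $r'$ of $b$, $\mathrm{Y}_{a,b}(r,r')=\sum_\sigma \mathrm{sign}(\sigma)$, the sum over all $\sigma\in S_n$ with $\sigma a=r$ and $\sigma b=r'$. For a word $w$, $V(w)$ is the complex vector space with basis the rearrangements of $w$, with $S_n$ permuting the basis. The Specht matrix of a complementary pair $(w_1,w_2)$ has rows indexed by rearrangements $r_1$ of $w_1$, columns indexed by rearrangements $r_2$ of $w_2$, and entries $\mathrm{Y}_{w_1,w_2}(r_1,r_2)$. The Specht module $V(\lambda)$ is the column span of this matrix inside $V(w_1)$, for a complementary pair corresponding to $\lambda$, with $S_n$ acting by restriction of its action on $V(w_1)$; up to isomorphism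 it depends only on $\lambda$. $S_l\times S_m$ is the subgroup of $S_{l+m}$ in which $S_l$ permutes the first $l$ positions and $S_m$ the last $m$; $\sigma\times\tau$ denotes the element of $S_{l+m}$ given by $\sigma\in S_l,\tau\in S_m$. $V(\lambda)\boxtimes V(\mu)$ is the tensor product with $S_l$ acting on the first factor and $S_m$ on the second; $\mathrm{Res}$ denotes restriction of the $S_{l+m}$-action to $S_l\times S_m$; $\otimes$ carries the diagonal action of $S_l\times S_m$; the superscript denotes invariants.
   Formalization: The formal theorem assumes that some part of λ, μ or ν exceeds 1; when λ=(1^l), μ=(1^m), ν=(1^{l+m}) the matrix L has a single column, so the polytope is a point of dimension 0 while the coefficient is 1, and the claim fails. *)

(* Defs.v *)
From HB Require Import structures.
From mathcomp Require Import all_boot all_order all_algebra all_fingroup.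
From mathcomp Require Import mxrepresentation character.
From mathcomp Require Import complex.
From mathcomp Require Import mathcomp_extra boolp classical_sets reals convex.

Set Implicit Arguments.
Unset Strict Implicit.
Unset Printing Implicit Defensive.

Import Order.TTheory GRing.Theory Num.Theory.
Local Open Scope ring_scope.

(* MathComp multiplies permutations from left to right, (s * t) i = t (s i).  *)
(* Hence word_act, which is the left action (s w)_i = w_{s^-1 i} for the      *)
(* usual composition of permutations, is a right action for MathComp's        *)
(* product, which is what {action _ &-> _} and mx_representation (acting on   *)
(* row vectors) ask for.                                                      *)

Section Words.
Variables (n : nat) (A : choiceType).

Definition word := {ffun 'I_n -> A}.

Definition word_act (s : 'S_n) (w : word) : word :=
  [ffun i => w ((s^-1)%g i)].

Lemma word_act1 w : word_act 1 w = w.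
Proof. by apply/ffunP=> i; rewrite ffunE invg1 perm1. Qed.

Lemma word_actM s t w : word_act (s * t) w = word_act t (word_act s w).
Proof. by apply/ffunP=> i; rewrite !ffunE invMg permM. Qed.

Definition rearrangements (w : word) : seq word :=
  [seq word_act s w | s : 'S_n].

Definition rearr (w : word) : finType := seq_sub (rearrangements w).

Lemma rearr_act_subproof w (r : rearr w) s :
  word_act s (val r) \in rearrangements w.
Proof.
have /fintype.imageP[t _ ->] := valP r.
by apply/fintype.imageP; exists (t * s)%g => //; rewrite word_actM.
Qed.

Definition rearr_act w (r : rearr w) (s : 'S_n) : rearr w :=
  SeqSub (rearr_act_subproof r s).

Lemma rearr_self_subproof w : w \in rearrangements w.
Proof. by apply/fintype.imageP; exists 1%g => //; rewrite word_act1. Qed.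

Definition rearr_self w : rearr w := SeqSub (rearr_self_subproof w).

Section DiagonalAction.
Variables w1 w2 : word.

Definition diag_fun (r : rearr w1 * rearr w2) (s : 'S_n) :=
  (rearr_act r.1 s, rearr_act r.2 s).

Lemma diag_fun1 r : diag_fun r 1%g = r.
Proof.
by case: r => r1 r2; congr pair; apply: val_inj; rewrite /= word_act1.
Qed.

Lemma diag_funM r : act_morph diag_fun r.
Proof. by move=> s t; congr pair; apply: val_inj; rewrite /= word_actM. Qed.

Definition diag_action : {action 'S_n &-> rearr w1 * rearr w2} :=
  TotalAction diag_fun1 diag_funM.

Definition free_orbits : {set {set rearr w1 * rearr w2}} :=
  [set O in [set orbit diag_action [set: 'S_n] x
              | x : rearr w1 * rearr w2]
     | [forall x in O, 'C[x | diag_action] == 1]]%SET%g.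

Definition complementary : Prop :=
  exists O, free_orbits = [set O]%SET /\
            (rearr_self w1, rearr_self w2) \in O.

End DiagonalAction.

Definition letter_counts (w : word) : seq nat :=
  sort geq [seq count_mem a (codom w) | a <- undup (codom w)].

Definition youngY (a b r r' : word) : int :=
  \sum_(s : 'S_n | (word_act s a == r) && (word_act s b == r')) (-1) ^+ s.

End Words.

Definition is_partition (n : nat) (la : seq nat) : bool :=
  [&& sorted geq la, 0%N \notin la & sumn la == n].

(* Indexed from 0: conj_part la j is the (j+1)-st part of the conjugate. *)
Definition conj_part (la : seq nat) (j : nat) : nat :=
  count (fun k => j < k)%N la.

Definition corresponds n (A : choiceType) (w1 w2 : word n A) (la : seq nat) :=
  forall j, nth 0%N (letter_counts w1) j = nth 0%N la j /\
            nth 0%N (letter_counts w2) j = conj_part la j.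

Definition complementary_for n (A : choiceType) (la : seq nat)
    (w1 w2 : word n A) : Prop :=
  complementary w1 w2 /\ corresponds w1 w2 la.

Section Specht.
Variables (F : fieldType) (n : nat) (A : choiceType).

(* V(w), as row vectors with coordinates indexed by enum (rearr w). *)
Definition word_mx (w : word n A) (s : 'S_n) : 'M[F]_#|rearr w| :=
  \matrix_(i, j) (rearr_act (enum_val i) s == enum_val j)%:R.

Lemma word_mx_repr w : mx_repr [set: 'S_n] (@word_mx w).
Proof.
split=> [|s t _ _]; apply/matrixP=> i j; rewrite !mxE.
  rewrite (_ : rearr_act _ _ = enum_val i) ?(inj_eq enum_val_inj) //.
  by apply: val_inj; rewrite /= word_act1.
rewrite (bigD1 (enum_rank (rearr_act (enum_val i) s))) //= !mxE enum_rankK.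
rewrite eqxx mul1r big1 ?addr0 => [|k neq_k].
  by congr ((_ == _)%:R); apply: val_inj; rewrite /= word_actM.
rewrite !mxE; case: eqP => [def_k | _]; last by rewrite mul0r.
by rewrite def_k enum_valK eqxx in neq_k.
Qed.

Definition word_repr w : mx_representation F [set: 'S_n] #|rearr w| :=
  MxRepresentation (word_mx_repr w).

Variables w1 w2 : word n A.

Definition specht_mx : 'M[F]_(#|rearr w1|, #|rearr w2|) :=
  \matrix_(i, j) (youngY w1 w2 (val (enum_val i)) (val (enum_val j)))%:~R.

Lemma youngY_act (a b r r' : word n A) t :
  youngY a b (word_act t r) (word_act t r') = (-1) ^+ t * youngY a b r r'.
Proof.
have actI (u v : word n A) : (word_act t u == word_act t v) = (u == v).
  apply/eqP/eqP=> [e|-> //].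
  by rewrite -(word_act1 u) -(word_act1 v) -(mulgV t) !word_actM e.
rewrite /youngY (reindex_inj (mulIg t)) mulr_sumr; apply: eq_big => s.
  by rewrite !word_actM !actI.
by move=> _; rewrite odd_permM signr_addb mulrC.
Qed.

(* The column span of specht_mx is the row space of its transpose; submod_repr *)
(* wants a square matrix, hence the genmx below.                              *)
Lemma specht_mxmodule : mxmodule (word_repr w1) specht_mx^T.
Proof.
apply/mxmoduleP=> s _; apply/row_subP=> j.
pose j' := enum_rank (rearr_act (enum_val j) s).
suff -> : row j (specht_mx^T *m word_repr w1 s)
          = (-1) ^+ s *: row j' specht_mx^T.
  by apply: scalemx_sub; apply: row_sub.
apply/rowP=> i; rewrite !mxE enum_rankK.
pose i' := enum_rank (rearr_act (enum_val i) s^-1).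
rewrite (bigD1 i') //= !mxE enum_rankK /=.
have actK (r : rearr w1) : rearr_act (rearr_act r s^-1) s = r.
  by apply: val_inj; rewrite /= -word_actM mulVg word_act1.
rewrite actK eqxx mulr1 big1 ?addr0 => [|k neq_k].
  rewrite -[in RHS](actK (enum_val i)) /= youngY_act rmorphM /= rmorph_sign.
  by rewrite mulrA -expr2 sqrr_sign mul1r.
rewrite !mxE; case: eqP => [def_i|_]; last by rewrite mulr0.
case/eqP: neq_k; apply: enum_val_inj; rewrite enum_rankK -def_i.
by apply: val_inj; rewrite /= -word_actM mulgV word_act1.
Qed.

Lemma specht_gen_mxmodule : mxmodule (word_repr w1) <<specht_mx^T>>%MS.
Proof. by rewrite (eqmx_module _ (genmxE _)) specht_mxmodule. Qed.

Definition specht_repr :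
    mx_representation F [set: 'S_n] (\rank <<specht_mx^T>>%MS) :=
  submod_repr specht_gen_mxmodule.

End Specht.

Section BlockPermutation.
Variables l m : nat.

Definition block_perm_fun (g : 'S_l * 'S_m) (i : 'I_(l + m)) : 'I_(l + m) :=
  match split i with
  | inl j => lshift m (g.1 j)
  | inr k => rshift l (g.2 k)
  end.

Lemma block_perm_inj g : injective (block_perm_fun g).
Proof.
apply: (can_inj (g := block_perm_fun (g^-1)%g)) => i.
rewrite /block_perm_fun -[i in RHS]splitK.
by case: (split i) => k; rewrite -/(unsplit (inl _)) -/(unsplit (inr _))
  ?(unsplitK (inl _)) ?(unsplitK (inr _)) /= permK.
Qed.

Definition block_perm (g : 'S_l * 'S_m) : 'S_(l + m) :=
  perm (@block_perm_inj g).

Lemma block_permM :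
  {in [set: 'S_l * 'S_m]%SET &, {morph block_perm : g h / (g * h)%g}}.
Proof.
move=> g h _ _; apply/permP=> i; rewrite permM !permE /block_perm_fun.
by case: (split i) => k; rewrite -/(unsplit (inl _)) -/(unsplit (inr _))
  ?(unsplitK (inl _)) ?(unsplitK (inr _)) /= permM.
Qed.

Canonical block_perm_morphism := Morphism block_permM.

End BlockPermutation.

Section PullBack.
Variables (F : fieldType) (gT rT : finGroupType).
Variables (f : {morphism [set: gT]%SET >-> rT}) (n : nat).
Variable rG : mx_representation F [set: rT] n.

Lemma pullback_sub : [set: gT]%SET \subset (f @*^-1 [set: rT])%g.
Proof. by rewrite -sub_morphim_pre ?subsetT. Qed.

Definition pullback_repr : mx_representation F [set: gT] n :=
  subg_repr (morphpre_repr f rG) pullback_sub.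

End PullBack.

(* Res is the pullback along block_perm; V(la) (x) V(mu), with each symmetric *)
(* group acting on its own factor, is the tensor product of the pullbacks     *)
(* along the two projections of 'S_l * 'S_m.                                  *)
Definition LR_coef (F : fieldType) (l m : nat) (A : choiceType)
    (x1 x2 : word l A) (y1 y2 : word m A) (w1 w2 : word (l + m) A) : nat :=
  \rank (rfix_mx
    (prod_repr
      (prod_repr
        (pullback_repr (@fst_morphism 'S_l 'S_m) (specht_repr F x1 x2))
        (pullback_repr (@snd_morphism 'S_l 'S_m) (specht_repr F y1 y2)))
      (pullback_repr (block_perm_morphism l m) (specht_repr F w1 w2)))
    [set: 'S_l * 'S_m]).

Section LittlewoodRichardsonMatrix.
Variables (R : realType) (l m : nat) (A : choiceType).
Variables (x1 x2 : word l A) (y1 y2 : word m A) (w1 w2 : word (l + m) A).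

Definition LR_entry (p : rearr x1) (q : rearr y1) (r : rearr w1)
    (s : rearr x2) (t : rearr y2) (u : rearr w2) : int :=
  \sum_(g : 'S_l * 'S_m)
     youngY x2 x1 (word_act g.1 (val s)) (val p) *
     youngY y2 y1 (word_act g.2 (val t)) (val q) *
     youngY w2 w1 (word_act (block_perm g) (val u)) (val r).

Definition LR_mx : 'M[R]_(#|{: rearr x1 * rearr y1 * rearr w1}|,
                          #|{: rearr x2 * rearr y2 * rearr w2}|) :=
  \matrix_(i, j)
     let: (p, q, r) := enum_val i in
     let: (s, t, u) := enum_val j in (LR_entry p q r s t u)%:~R.

End LittlewoodRichardsonMatrix.

Section Polytope.
Variables (R : realType) (V : vectType R).
Local Open Scope classical_set_scope.

Definition convex_hull (X : set V) : set V := smallest (@convex_set R V) X.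

Definition affine_set (X : set V) : Prop :=
  forall (x y : V) (t : R), X x -> X y -> X ((1 - t) *: x + t *: y).

Definition affine_hull (X : set V) : set V := smallest affine_set X.

(* The dimension of a nonempty convex set is that of its affine hull. *)
Definition has_dim (X : set V) (d : nat) : Prop :=
  exists (x0 : V) (U : {vspace V}),
    affine_hull X = [set x0 + u | u in [set` U]] /\ \dim U = d.

End Polytope.

Definition LR_polytope (R : realType) l m (A : choiceType)
    (x1 x2 : word l A) (y1 y2 : word m A) (w1 w2 : word (l + m) A) :
    set 'cV[R]_#|{: rearr x1 * rearr y1 * rearr w1}| :=
  convex_hull (range (fun j => col j (LR_mx R x1 x2 y1 y2 w1 w2))).

Arguments LR_polytope R {l m A} x1 x2 y1 y2 w1 w2.

(* Main.v *)
Require Import Defs.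
From mathcomp Require Import all_boot all_order all_algebra all_fingroup.
From mathcomp Require Import mxrepresentation character mxtens complex.
From mathcomp Require Import boolp classical_sets reals convex.
From mathcomp Require Import ring zify.

(* Write L = S P, where S is the Kronecker product of the three Specht matrices
   and P sums the permutation matrices of S_l x S_m.  As S is equivariant, L is
   also the (unnormalized) projection onto the invariants applied to S, so its
   column space is the space of invariants of the tensor product of the Specht
   modules, and rank L = c.  If some part of la, mu or nu exceeds 1, a
   transposition fixes x1, y1 or w1, so the corresponding Specht matrix, hence
   also L, has zero row sums.  Then 0 is the barycenter of the columns of L, and
   their affine hull is their linear span.  Two complementary pairs for the same
   partition differ by a relabelling of letters and a permutation of positions,
   which changes L only by a sign and a reindexing. *)

Set Implicit Arguments.
Unset Strict Implicit.
Unset Printing Implicit Defensive.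

Import Order.TTheory GRing.Theory Num.Theory.
Local Open Scope ring_scope.

(** * Ranks of submatrices and of Kronecker products *)

Section MatrixRank.
Variable F : fieldType.

(** Reindexing is multiplication by selection matrices on both sides, so [f] and [g] need not be
    injective. Two matrices that are each an [mxsub] of the other thus have equal rank, with no
    bijection to build. *)
Lemma mxrank_mxsub (m n p q : nat) (f : 'I_p -> 'I_m) (g : 'I_q -> 'I_n)
    (M : 'M[F]_(m, n)) :
  (\rank (mxsub f g M) <= \rank M)%N.
Proof.
have -> : mxsub f g M = rowsub f 1%:M *m M *m colsub g 1%:M.
  by rewrite -{1}[M]mul1mx -[in LHS](mulmx1 (_ *m M)) mxsub_mul -mul_rowsub_mx.
exact: leq_trans (mxrankM_maxl _ _) (mxrankM_maxr _ _).
Qed.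

Lemma eqmx_mxrankMr (m n p q : nat) (M : 'M[F]_(m, p)) (N : 'M[F]_(n, p))
    (P : 'M[F]_(p, q)) :
  (M :=: N)%MS -> \rank (M *m P) = \rank (N *m P).
Proof. by move=> /(eqmxMr P) ->. Qed.

(** [prod_repr] is built on the recursive block construction [tprod]; entries are easier to read off
    [tensmx], whose indices are pairs. *)
Lemma tprod_tens (m n p q : nat) (M : 'M[F]_(m, n)) (N : 'M[F]_(p, q)) :
  tprod M N = tensmx M N.
Proof.
have trowE k (v : 'rV[F]_k) i j l :
    trow v N i (mxtens_index (j, l)) = v 0 j * N i l.
  elim: k v j => [|k IH] v j /=; first by case: j.
  case: (unliftP 0 j) => [j' ->|->].
    have -> : mxtens_index (lift 0 j', l) = rshift q (mxtens_index (j', l)).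
      by apply: val_inj; rewrite /= /bump /= mulnDl mul1n addnA.
    rewrite row_mxEr IH mxE; congr (v _ _ * _).
    by apply: val_inj.
  have -> : mxtens_index (ord0 : 'I_k.+1, l) = lshift (k * q) l.
    exact: val_inj.
  rewrite row_mxEl !mxE; congr (v _ _ * _).
  exact: val_inj.
apply/matrixP => i j.
case: (mxtens_indexP i) => {}i i'; case: (mxtens_indexP j) => {}j j'.
rewrite tensmxE.
elim: m M i => [|m IH] M i /=; first by case: i.
case: (unliftP 0 i) => [i0 ->|->].
  have -> : mxtens_index (lift 0 i0, i') = rshift p (mxtens_index (i0, i')).
    by apply: val_inj; rewrite /= /bump /= mulnDl mul1n addnA.
  rewrite col_mxEd IH mxE; congr (M _ _ * _).
  exact: val_inj.
have -> : mxtens_index (ord0 : 'I_m.+1, i') = lshift (m * p) i'.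
  exact: val_inj.
rewrite col_mxEu trowE mxE; congr (M _ _ * _).
exact: val_inj.
Qed.

Lemma row_free_tprod (m n p q : nat) (M : 'M[F]_(m, n)) (N : 'M[F]_(p, q)) :
  row_free M -> row_free N -> row_free (tprod M N).
Proof.
case/row_freeP=> M' MM' /row_freeP[N' NN'].
by apply/row_freeP; exists (tprod M' N'); rewrite -tprodE MM' NN' tprod1.
Qed.

Lemma eqmx_tprod (m n p m' n' p' : nat) (M : 'M[F]_(m, p)) (N : 'M[F]_(n, p))
    (M' : 'M[F]_(m', p')) (N' : 'M[F]_(n', p')) :
  (M :=: N)%MS -> (M' :=: N')%MS -> (tprod M M' :=: tprod N N')%MS.
Proof.
move=> eqMN eqMN'; apply/eqmxP/andP; split.
  have /submxP[D defM] : (M <= N)%MS by rewrite eqMN.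
  have /submxP[D' defM'] : (M' <= N')%MS by rewrite eqMN'.
  by rewrite defM defM' tprodE submxMl.
have /submxP[D defN] : (N <= M)%MS by rewrite eqMN.
have /submxP[D' defN'] : (N' <= M')%MS by rewrite eqMN'.
by rewrite defN defN' tprodE submxMl.
Qed.

End MatrixRank.

(** * Invariants of a finite group by averaging *)

Section Invariants.
Variables (F : fieldType) (gT : finGroupType) (n : nat).
Variable rG : mx_representation F [set: gT]%SET n.
Hypothesis charG : #|[set: gT]%SET|%:R != 0 :> F.

(** The sum over the group multiplies an invariant vector by the group order, which is invertible;
    conversely, right translation permutes the summands, so the rows of the sum are invariant. *)
Lemma rfix_mx_avg : (rfix_mx rG [set: gT]%SET :=: (\sum_g rG g)%R)%MS.
Proof.
apply/eqmxP/andP; split.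
  rewrite -(eqmx_scale (rfix_mx _ _) charG) scaler_nat.
  have -> : rfix_mx rG [set: gT]%SET *+ #|[set: gT]%SET|
      = rfix_mx rG [set: gT]%SET *m (\sum_g rG g).
    rewrite mulmx_sumr -sumr_const.
    apply: eq_big => [g|g _]; first by rewrite inE.
    by rewrite rfix_mx_id ?inE.
  exact: submxMl.
apply/rfix_mxP => h _; rewrite mulmx_suml [RHS](reindex_inj (mulIg h)) /=.
by apply: eq_bigr => g _; rewrite repr_mxM ?inE.
Qed.

(** A row-free [B] embeds the representation in a space where [g] acts by [W g]. This preserves
    ranks, so the averaging can be done with the explicit matrices [W g]. *)
Lemma mxrank_rfix_intertwine (p : nat) (B : 'M[F]_(n, p)) (W : gT -> 'M[F]_p) :
    row_free B -> (forall g, rG g *m B = B *m W g) ->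
  \rank (rfix_mx rG [set: gT]%SET) = \rank (B *m \sum_g W g).
Proof.
move=> freeB rGB; rewrite rfix_mx_avg -(mxrankMfree _ freeB).
by rewrite mulmx_suml mulmx_sumr (eq_bigr _ (fun g _ => rGB g)).
Qed.

End Invariants.

(** * Signs and translates of Specht matrices *)

Lemma sign_block_perm (l m : nat) (g : 'S_l * 'S_m) :
  (-1) ^+ block_perm g = (-1) ^+ g.1 * (-1) ^+ g.2 :> int.
Proof.
(* The sign is the determinant of the permutation matrix, which is block diagonal here. *)
rewrite -!det_perm.
have -> : perm_mx (block_perm g) = block_mx (perm_mx g.1) 0 0 (perm_mx g.2)
    :> 'M[int]_(l + m).
  apply/matrixP => i j; rewrite !mxE permE /block_perm_fun.
  case: (splitP i) => i' _; rewrite mxE; case: (splitP j) => j' def_j;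
    rewrite !mxE -val_eqE /= def_j ?eqn_add2l //.
  - by rewrite ltn_eqF // ltn_addr.
  - by rewrite gtn_eqF // ltn_addr.
exact: det_ublock.
Qed.

Lemma youngYC (n : nat) (A : choiceType) (a b r r' : word n A) :
  youngY a b r r' = youngY b a r' r.
Proof. by apply: eq_bigl => s; rewrite andbC. Qed.

(** Multiplying by [word_mx] replaces the rearrangement of [w1] by its translate under [s^-1];
    moving both arguments of [youngY] by [s] costs the sign. *)
Lemma specht_word_mxE (F : fieldType) (n : nat) (A : choiceType)
    (w1 w2 : word n A) (s : 'S_n) i j :
  ((specht_mx F w1 w2)^T *m word_mx F w1 s) j i =
    (-1) ^+ s * (youngY w2 w1 (word_act s (val (enum_val j)))
                              (val (enum_val i)))%:~R.
Proof.
have actK (r : rearr w1) : rearr_act (rearr_act r s^-1) s = r.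
  by apply: val_inj; rewrite /= -word_actM mulVg word_act1.
rewrite !mxE (bigD1 (enum_rank (rearr_act (enum_val i) s^-1))) //=.
rewrite !mxE enum_rankK actK eqxx mulr1 big1 ?addr0 => [|k neq_k].
  rewrite -[in RHS](actK (enum_val i)) /= youngY_act youngYC rmorphM /=.
  by rewrite rmorph_sign mulrA -expr2 sqrr_sign mul1r.
rewrite !mxE; case: eqP => [def_i|_]; last by rewrite mulr0.
case/eqP: neq_k; apply: enum_val_inj; rewrite enum_rankK -def_i.
by apply: val_inj; rewrite /= -word_actM mulgV word_act1.
Qed.

(** * The Littlewood-Richardson coefficient as a rank *)

Section LittlewoodRichardsonRank.
Variables (F : numFieldType) (l m : nat) (A : choiceType).

(** The field is left open because the matrix is needed over [R] for the polytope and over [R[i]]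
    for the coefficient. *)
Definition LR_fmx (x1 x2 : word l A) (y1 y2 : word m A)
    (w1 w2 : word (l + m) A) :
    'M[F]_(#|{: rearr x1 * rearr y1 * rearr w1}|,
           #|{: rearr x2 * rearr y2 * rearr w2}|) :=
  \matrix_(i, j) (LR_entry (enum_val i).1.1 (enum_val i).1.2 (enum_val i).2
                     (enum_val j).1.1 (enum_val j).1.2 (enum_val j).2)%:~R.

Variables (x1 x2 : word l A) (y1 y2 : word m A) (w1 w2 : word (l + m) A).

(** Kronecker products and enumerated triples index the same set differently; [pair_ix] and
    [tens_ix] convert between the two. *)
Let pair_ix (T1 T2 T3 : finType) (k : 'I_(#|T1| * #|T2| * #|T3|)) :=
  enum_rank (enum_val (mxtens_unindex (mxtens_unindex k).1).1,
             enum_val (mxtens_unindex (mxtens_unindex k).1).2,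
             enum_val (mxtens_unindex k).2).

Let tens_ix (T1 T2 T3 : finType) (k : 'I_#|{: T1 * T2 * T3}|) :=
  mxtens_index (mxtens_index (enum_rank (enum_val k).1.1,
    enum_rank (enum_val k).1.2), enum_rank (enum_val k).2).

Let tens_ixK T1 T2 T3 : cancel (@tens_ix T1 T2 T3) (@pair_ix T1 T2 T3).
Proof.
move=> k; rewrite /pair_ix /tens_ix !mxtens_indexK /= !enum_rankK.
by rewrite -!surjective_pairing enum_valK.
Qed.

(* As the symmetric groups twist both sides of a Specht matrix by the sign,
   and the signs of [g.1], [g.2] and [block_perm g] multiply to 1, the LR
   matrix is the sum over the group of the translates of the Kronecker product
   of the three Specht matrices. *)
Lemma LR_fmx_sum :
  tprod (tprod (specht_mx F x1 x2)^T (specht_mx F y1 y2)^T)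
        (specht_mx F w1 w2)^T
    *m (\sum_g tprod (tprod (word_mx F x1 g.1) (word_mx F y1 g.2))
                     (word_mx F w1 (block_perm g)))
  = mxsub (@pair_ix _ _ _) (@pair_ix _ _ _) (LR_fmx x1 x2 y1 y2 w1 w2)^T.
Proof.
rewrite mulmx_sumr; apply/matrixP => j i; rewrite summxE !mxE !enum_rankK /=.
rewrite rmorph_sum; apply: eq_bigr => g _ /=.
rewrite -!tprodE !tprod_tens [LHS]mxE [X in X * _ = _]mxE !specht_word_mxE.
have sgnF : (-1) ^+ block_perm g = (-1) ^+ g.1 * (-1) ^+ g.2 :> F.
  by have /(congr1 (intr : int -> F)) := sign_block_perm g;
    rewrite rmorphM !rmorph_sign.
rewrite !rmorphM /= sgnF [X in X * _ = _]mulrACA [LHS]mulrACA.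
by rewrite -expr2 exprMn !sqrr_sign !mul1r.
Qed.

Lemma LR_coef_rank :
  LR_coef F x1 x2 y1 y2 w1 w2 = \rank (LR_fmx x1 x2 y1 y2 w1 w2).
Proof.
have charG : #|[set: 'S_l * 'S_m]|%:R != 0 :> F.
  by rewrite pnatr_eq0 -lt0n cardG_gt0.
(* The rows of [B] are a basis of the Specht module in the coordinates of [V(v1)], where the action
   is by permutation matrices. *)
pose B n (v1 v2 : word n A) :=
  val_submod (1%:M : 'M_(\rank <<(specht_mx F v1 v2)^T>>%MS)).
have freeB n (v1 v2 : word n A) : row_free (B n v1 v2).
  by rewrite /row_free val_submod1.
have eqB n (v1 v2 : word n A) : (B n v1 v2 :=: (specht_mx F v1 v2)^T)%MS.
  exact: eqmx_trans (val_submod1 _) (genmxE _).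
have actB n (v1 v2 : word n A) s :
    specht_repr F v1 v2 s *m B n v1 v2 = B n v1 v2 *m word_mx F v1 s.
  have := val_submodJ (specht_gen_mxmodule F v1 v2) 1%:M (finset.in_setT s).
  by rewrite mul1mx val_submodE.
rewrite /LR_coef (@mxrank_rfix_intertwine _ _ _ _ charG _
  (tprod (tprod (B _ x1 x2) (B _ y1 y2)) (B _ w1 w2))
  (fun g => tprod (tprod (word_mx F x1 g.1) (word_mx F y1 g.2))
                  (word_mx F w1 (block_perm g)))); first last.
- by move=> g; rewrite -!tprodE /= -!actB !tprodE.
- by rewrite !row_free_tprod.
rewrite (eqmx_mxrankMr _ (eqmx_tprod (eqmx_tprod (eqB _ _ _) (eqB _ _ _))
  (eqB _ _ _))) LR_fmx_sum -[RHS]mxrank_tr.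
apply/eqP; rewrite eqn_leq mxrank_mxsub /=.
set M := (LR_fmx _ _ _ _ _ _)^T; set N := mxsub _ _ M.
have -> : M = mxsub (@tens_ix _ _ _) (@tens_ix _ _ _) N.
  by apply/matrixP => i j; rewrite [RHS]mxE [RHS]mxE !tens_ixK.
exact: mxrank_mxsub.
Qed.

End LittlewoodRichardsonRank.

(** * Relabelling complementary pairs *)

Section Relabelling.
Variables (n : nat) (A : choiceType).

Definition relabel (phi : A -> A) (w : word n A) : word n A :=
  [ffun i => phi (w i)].

Lemma relabel_act phi s w :
  relabel phi (word_act s w) = word_act s (relabel phi w).
Proof. by apply/ffunP => i; rewrite !ffunE. Qed.

Lemma relabel_act_inj phi (w : word n A) s t :
    {in codom w &, injective phi} ->
  relabel phi (word_act s w) = relabel phi (word_act t w) ->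
  word_act s w = word_act t w.
Proof.
move=> inj_phi /ffunP eq_st; apply/ffunP => i.
by have := eq_st i; rewrite !ffunE; apply: inj_phi; apply: codom_f.
Qed.

Lemma letter_counts_gt0 (w : word n A) k : k \in letter_counts w -> (0 < k)%N.
Proof.
rewrite mem_sort => /mapP[a]; rewrite mem_undup => w_a ->.
by rewrite -has_count has_pred1.
Qed.

(** Every listed count is positive, so the default 0 of [nth] reveals where each list ends. *)
Lemma eq_letter_counts (v w : word n A) :
    (forall j, nth 0%N (letter_counts v) j = nth 0%N (letter_counts w) j) ->
  letter_counts v = letter_counts w.
Proof.
have le_size (u u' : word n A) :
    (forall j, nth 0%N (letter_counts u) j = nth 0%N (letter_counts u') j) ->
  (size (letter_counts u) <= size (letter_counts u'))%N.
  move=> eq_nth; rewrite leqNgt; apply/negP => lt_size.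
  have := letter_counts_gt0 (mem_nth 0%N lt_size).
  by rewrite eq_nth nth_default.
move=> eq_nth; apply: (@eq_from_nth _ 0%N) => [|j _]; last exact: eq_nth.
by apply/eqP; rewrite eqn_leq !le_size.
Qed.

Lemma perm_eq_word_act (v w : word n A) :
  perm_eq (codom v) (codom w) -> exists s, v = word_act s w.
Proof.
have codomE (u : word n A) : codom u = [tuple u i | i < n].
  by rewrite codomE.
rewrite (codomE v) (codomE w) => /tuple_permP[s eq_vw].
exists (s^-1)%g; apply/ffunP => i; rewrite ffunE invgK.
have := congr1 (fun t => tnth t i) (val_inj eq_vw).
by rewrite !tnth_mktuple.
Qed.

(** Sort the distinct letters of each word by multiplicity and match them by position; the
    relabelled [v] then has every letter as often as [w] does. *)
Lemma relabel_letter_counts (v w : word n A) :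
    letter_counts v = letter_counts w ->
  exists phi s, {in codom v &, injective phi} /\
                relabel phi v = word_act s w.
Proof.
rewrite /letter_counts !sort_map.
set sv := sort _ (undup (codom v)); set sw := sort _ (undup (codom w)).
move=> eq_counts.
have mem_sv : sv =i codom v by move=> c; rewrite mem_sort mem_undup.
have mem_sw : sw =i codom w by move=> c; rewrite mem_sort mem_undup.
have uniq_sv : uniq sv by rewrite sort_uniq undup_uniq.
have uniq_sw : uniq sw by rewrite sort_uniq undup_uniq.
have eq_size : size sv = size sw.
  by have /(congr1 size) := eq_counts; rewrite !size_map.
(* The default [c] avoids choosing an element of [A], which may be empty; it is never reached for
   [c] in [sv]. *)
pose phi c := nth c sw (index c sv).
have phiE c d : c \in sv -> phi c = nth d sw (index c sv).
  by move=> sv_c; apply: set_nth_default; rewrite -eq_size index_mem.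
have inj_phi : {in sv &, injective phi}.
  move=> c d sv_c sv_d; rewrite (phiE c c) // (phiE d c) // => /eqP.
  rewrite nth_uniq -?eq_size ?index_mem // => /eqP eq_ix.
  by rewrite -(nth_index c sv_c) eq_ix nth_index.
have map_phi : map phi sv = sw.
  case sv_nil: sv => [|c0 s0].
    by move: eq_size; rewrite sv_nil; case: (sw).
  rewrite -sv_nil; apply: (@eq_from_nth _ c0); rewrite size_map // => j ltj.
  by rewrite (nth_map c0) // (phiE _ c0) ?mem_nth // index_uniq.
have count_phi c : c \in sv ->
    count_mem (phi c) (codom w) = count_mem c (codom v).
  move=> sv_c; have ltj : (index c sv < size sv)%N by rewrite index_mem.
  have := congr1 (fun s => nth 0%N s (index c sv)) eq_counts.
  rewrite (nth_map c) // nth_index // (nth_map c) -?eq_size // => <-.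
exists phi.
suff /perm_eq_word_act[s defv] : perm_eq (codom (relabel phi v)) (codom w).
  exists s; split=> // c d; rewrite -!mem_sv; exact: inj_phi.
have -> : codom (relabel phi v) = map phi (codom v).
  by rewrite -map_comp; apply: eq_map => i; rewrite ffunE.
rewrite /perm_eq; apply/allP => c _ /=; apply/eqP.
have [|sw'c] := boolP (c \in sw).
  rewrite -map_phi => /mapP[d sv_d ->]; rewrite count_phi // count_map.
  apply: eq_in_count => e; rewrite -mem_sv => sv_e /=.
  by rewrite (inj_in_eq inj_phi).
rewrite !(count_memPn _) // -?mem_sw //; apply: contra sw'c => /mapP[d v_d ->].
by rewrite -map_phi map_f // mem_sv.
Qed.

Lemma complementary_stab (w1 w2 : word n A) s :
    complementary w1 w2 -> word_act s w1 = w1 -> word_act s w2 = w2 ->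
  s = 1%g.
Proof.
case=> O [freeO O_w] fix1 fix2.
have : O \in free_orbits w1 w2 by rewrite freeO set11.
rewrite inE => /andP[_ /forall_inP/(_ _ O_w)/eqP stab1].
apply/set1gP; rewrite -stab1; apply/astab1P.
by congr pair; apply: val_inj.
Qed.

(** A point with trivial stabilizer lies in a free orbit, and the only free orbit is that of
    [(w1, w2)]. *)
Lemma complementary_orbit (w1 w2 : word n A) (r : rearr w1 * rearr w2) :
    complementary w1 w2 ->
    (forall s, word_act s (val r.1) = val r.1 ->
               word_act s (val r.2) = val r.2 -> s = 1%g) ->
  exists t, val r.1 = word_act t w1 /\ val r.2 = word_act t w2.
Proof.
case=> O [freeO O_w] stab_r.
have : orbit (diag_action w1 w2) [set: 'S_n] r \in free_orbits w1 w2.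
  rewrite inE imset_f //=; apply/forall_inP => _ /orbitP[s _ <-].
  apply/eqP/trivgP/fintype.subsetP => t.
  move=> /astab1P eq_t.
  have fix1 := congr1 (fun u => val u.1) eq_t.
  have fix2 := congr1 (fun u => val u.2) eq_t.
  (* Stabilizers along an orbit are conjugate. *)
  have fix_conj (w : word n A) :
      word_act t (word_act s w) = word_act s w ->
    word_act (s * t * s^-1)%g w = w.
    by move=> fix_w; rewrite !word_actM fix_w -word_actM mulgV word_act1.
  have /eqP := stab_r _ (fix_conj _ fix1) (fix_conj _ fix2).
  by rewrite -eq_mulgV1 -[X in _ == X]mulg1 (inj_eq (mulgI s)) inE.
rewrite freeO inE => /eqP defO.
move: O_w; rewrite -defO => /orbitP[s _ def_w].
have def_w1 := congr1 (fun u => val u.1) def_w.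
have def_w2 := congr1 (fun u => val u.2) def_w.
exists (s^-1)%g; split.
  by rewrite -[RHS](congr1 _ def_w1) -word_actM mulgV word_act1.
by rewrite -[RHS](congr1 _ def_w2) -word_actM mulgV word_act1.
Qed.

End Relabelling.

Lemma relabel_rearr (n : nat) (A : choiceType) (v w : word n A)
    (phi : A -> A) (s : 'S_n) (r : rearr v) :
  relabel phi v = word_act s w -> relabel phi (val r) \in rearrangements w.
Proof.
move=> phi_v; have /fintype.imageP[t _ ->] := valP r.
rewrite relabel_act phi_v -word_actM.
by apply/fintype.imageP; exists (s * t)%g.
Qed.

(** Relabellings injective on letters keep the stabilizer trivial, so a single [t] carries
    [(x1, x2)] to the relabelled pair, although [s1] and [s2] were found separately. Shifting the
    sum by [t] produces the sign. *)
Lemma relabel_youngY (n : nat) (A : choiceType) (a1 a2 x1 x2 : word n A) :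
    complementary a1 a2 -> complementary x1 x2 ->
    letter_counts a1 = letter_counts x1 ->
    letter_counts a2 = letter_counts x2 ->
  exists (f1 : rearr a1 -> rearr x1) (f2 : rearr a2 -> rearr x2) (e : bool),
    forall r1 r2 s,
      youngY a2 a1 (word_act s (val r2)) (val r1) =
      (-1) ^+ e * youngY x2 x1 (word_act s (val (f2 r2))) (val (f1 r1)).
Proof.
move=> compl_a compl_x /relabel_letter_counts[phi1 [s1 [inj1 def1]]].
move=> /relabel_letter_counts[phi2 [s2 [inj2 def2]]].
pose f1 r : rearr x1 := SeqSub (relabel_rearr r def1).
pose f2 r : rearr x2 := SeqSub (relabel_rearr r def2).
have fix_relabel (phi : A -> A) (a : word n A) s :
    {in codom a &, injective phi} ->
    word_act s (relabel phi a) = relabel phi a -> word_act s a = a.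
  move=> inj_phi; rewrite -relabel_act -{2 4}(word_act1 a).
  exact: relabel_act_inj.
have [|t [/= def1' def2']] :=
    complementary_orbit (r := (f1 (rearr_self a1), f2 (rearr_self a2))) compl_x.
  move=> s /= /(fix_relabel _ _ _ inj1) fix1 /(fix_relabel _ _ _ inj2) fix2.
  exact: complementary_stab compl_a fix1 fix2.
exists f1, f2, (odd_perm t) => r1 r2 s.
have actE (phi : A -> A) (a x r : word n A) u :
    {in codom a &, injective phi} -> relabel phi a = word_act t x ->
    r \in rearrangements a ->
  (word_act u a == r) = (word_act (t * u) x == relabel phi r).
  move=> inj_phi def_a /fintype.imageP[s' _ ->].
  rewrite word_actM -def_a -relabel_act.
  by apply/eqP/eqP => [-> // | /relabel_act_inj->].
rewrite [in RHS]/youngY (reindex_inj (mulgI t)) mulr_sumr /=.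
apply: eq_big => u => [|_]; last first.
  by rewrite odd_permM signr_addb mulrA -expr2 sqrr_sign mul1r.
rewrite (actE _ _ _ _ _ inj1 def1' (valP r1)) -relabel_act.
by rewrite (actE _ _ _ _ _ inj2 def2' (valP (rearr_act r2 s))).
Qed.

(** * Independence of the chosen complementary pairs *)

Section Independence.
Variables (F : numFieldType) (l m : nat) (A : choiceType) (la mu nu : seq nat).

(** The hypotheses are symmetric in the two families of pairs, so this inequality yields
    equality. *)
Lemma mxrank_LR_fmx_le (x1 x2 a1 a2 : word l A) (y1 y2 b1 b2 : word m A)
    (w1 w2 c1 c2 : word (l + m) A) :
    complementary_for la x1 x2 -> complementary_for mu y1 y2 ->
    complementary_for nu w1 w2 -> complementary_for la a1 a2 ->
    complementary_for mu b1 b2 -> complementary_for nu c1 c2 ->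
  (\rank (LR_fmx F a1 a2 b1 b2 c1 c2) <= \rank (LR_fmx F x1 x2 y1 y2 w1 w2))%N.
Proof.
have relabel_for n ka (u1 u2 v1 v2 : word n A) :
    complementary_for ka u1 u2 -> complementary_for ka v1 v2 ->
  exists (f1 : rearr v1 -> rearr u1) (f2 : rearr v2 -> rearr u2) (e : bool),
    forall r1 r2 s,
      youngY v2 v1 (word_act s (val r2)) (val r1) =
      (-1) ^+ e * youngY u2 u1 (word_act s (val (f2 r2))) (val (f1 r1)).
  case=> compl_u ka_u [compl_v ka_v]; apply: relabel_youngY => //.
    apply: eq_letter_counts => j.
    by have [-> _] := ka_v j; have [-> _] := ka_u j.
  apply: eq_letter_counts => j.
  by have [_ ->] := ka_v j; have [_ ->] := ka_u j.
move=> hx hy hw ha hb hc.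
have [f1 [f2 [e1 eqx]]] := relabel_for _ _ _ _ _ _ hx ha.
have [g1 [g2 [e2 eqy]]] := relabel_for _ _ _ _ _ _ hy hb.
have [h1 [h2 [e3 eqw]]] := relabel_for _ _ _ _ _ _ hw hc.
pose row_ix (i : 'I_#|{: rearr a1 * rearr b1 * rearr c1}|) := let r := enum_val i in
  enum_rank (f1 r.1.1, g1 r.1.2, h1 r.2).
pose col_ix (i : 'I_#|{: rearr a2 * rearr b2 * rearr c2}|) := let r := enum_val i in
  enum_rank (f2 r.1.1, g2 r.1.2, h2 r.2).
have -> : LR_fmx F a1 a2 b1 b2 c1 c2 = ((-1) ^+ e1 * (-1) ^+ e2 * (-1) ^+ e3)
    *: mxsub row_ix col_ix (LR_fmx F x1 x2 y1 y2 w1 w2).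
  apply/matrixP => i j; rewrite !mxE !enum_rankK /=.
  rewrite -!(rmorph_sign (intr : int -> F)) -!rmorphM; congr (_%:~R).
  rewrite mulr_sumr; apply: eq_bigr => g _.
  by rewrite eqx eqy eqw [X in X * _ = _]mulrACA [LHS]mulrACA.
exact: leq_trans (mxrank_scale _ _) (mxrank_mxsub _ _ _).
Qed.

End Independence.

(** * Column spans and affine hulls *)

Lemma dim_col_span (F : fieldType) (m n : nat) (M : 'M[F]_(m, n)) :
  \dim <<[tuple col j M | j < n]>> = \rank M.
Proof.
have col_mul_span k p (P : 'M[F]_(m, k)) (Q : 'M[F]_(k, p)) :
    (<<[tuple col j (P *m Q) | j < p]>> <= <<[tuple col j P | j < k]>>)%VS.
  apply/span_subvP => _ /tnthP[j ->]; rewrite tnth_mktuple.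
  have -> : col j (P *m Q) = \sum_i Q i j *: col i P.
    apply/colP => r; rewrite summxE !mxE; apply: eq_bigr => i _.
    by rewrite !mxE mulrC.
  apply: memv_suml => i _; apply/memvZ/memv_span.
  by apply/tnthP; exists i; rewrite tnth_mktuple.
(* [C] has the same column span as [M], because [row_base M] has a right inverse, and its columns
   are independent. *)
set C := col_base M.
have -> : <<[tuple col j M | j < n]>>%VS = <<[tuple col j C | j < \rank M]>>%VS.
  apply/eqP; rewrite eqEsubv -{1}(mulmx_base M) col_mul_span /=.
  have /row_freeP[D RD] := row_base_free M.
  by rewrite {1}/C -[col_base M]mulmx1 -RD mulmxA mulmx_base col_mul_span.
rewrite (eqnP (_ : free _)) ?size_tuple //.
apply/freeP => k sum0 i.
suff /colP/(_ i) : \col_j k j = 0 by rewrite !mxE.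
apply: (row_full_inj (col_base_full M)); rewrite mulmx0 -[RHS]sum0.
apply/colP => r; rewrite summxE !mxE; apply: eq_bigr => j _.
by rewrite nth_mktuple !mxE mulrC.
Qed.

Section AffineHull.
Variables (R : realType) (V : vectType R).
Local Open Scope classical_set_scope.

(** The mean of k + 1 points is an affine combination of one of them, with weight 1/(k + 1), and the
    mean of the other k. *)
Lemma affine_mean (T : set V) (v : V) (s : seq V) :
    affine_set T -> (forall u, u \in v :: s -> T u) ->
  T ((size s).+1%:R^-1 *: \sum_(u <- v :: s) u).
Proof.
move=> affT; elim: s v => [|w s IH] v sT.
  by rewrite big_seq1 invr1 scale1r; apply: sT; rewrite mem_head.
rewrite big_cons.
set k := (size s).+1; set S := \sum_(u <- w :: s) u.
have -> : (size (w :: s)).+1%:R^-1 *: (v + S) =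
    (1 - k.+1%:R^-1) *: (k%:R^-1 *: S) + k.+1%:R^-1 *: v :> V.
  rewrite addrC scalerDr scalerA; congr (_ *: _ + _).
  have k0 : k%:R != 0 :> R by rewrite pnatr_eq0.
  have k1 : k%:R + 1 != 0 :> R by rewrite natr1 pnatr_eq0.
  by rewrite -[(size _).+1]/k.+1 -natr1; field; rewrite k0 k1.
apply: affT; last by apply: sT; rewrite mem_head.
by apply: IH => u s_u; apply: sT; rewrite inE s_u orbT.
Qed.

(** Lines through 0 give closure under scaling, and u + v is the midpoint of 2u and 2v. *)
Lemma affine_linear (T : set V) (s : seq V) :
  affine_set T -> T 0 -> (forall u, u \in s -> T u) -> [set` <<s>>%VS] `<=` T.
Proof.
move=> affT T0 sT.
have TZ a u : T u -> T (a *: u).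
  by move=> Tu; have := affT _ _ a T0 Tu; rewrite scaler0 add0r.
have TD u v : T u -> T v -> T (u + v).
  move=> Tu Tv; have := affT _ _ (2^-1) (TZ 2 _ Tu) (TZ 2 _ Tv).
  rewrite !scalerA mulVf ?pnatr_eq0 // scale1r mulrBl mul1r mulVf ?pnatr_eq0 //.
  by rewrite -[2 - 1]/(1 + 1 - 1) addrK scale1r.
move=> u /= /(@coord_span _ _ _ (in_tuple s)) ->.
by apply: big_ind => // i _; apply/TZ/sT/mem_nth.
Qed.

Lemma has_dim_convex_hull (n : nat) (f : 'I_n -> V) :
    (0 < n)%N -> \sum_i f i = 0 ->
  has_dim (convex_hull (range f)) (\dim <<[tuple f i | i < n]>>).
Proof.
move=> n_gt0 sum0; exists 0, <<[tuple f i | i < n]>>%VS; split=> //.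
have -> : [set 0 + u | u in [set` <<[tuple f i | i < n]>>%VS]] =
    [set` <<[tuple f i | i < n]>>%VS].
  rewrite -[RHS]image_id; congr image.
  by apply/funext => u; rewrite add0r.
(* A linear subspace is both convex and affine, so the span contains both hulls. *)
apply/seteqP; split.
  apply: smallest_sub => [u v t /= uU vU|].
    by rewrite rpredD // rpredZ.
  apply: smallest_sub => [u v t uU vU|_ [i _ <-]] /=.
    rewrite !inE /= in uU vU *.
    exact: (@memvD _ V _ _ _ (memvZ _ uU) (memvZ _ vU)).
  by apply: memv_span; rewrite map_f ?mem_enum.
(* Conversely, an affine set containing the convex hull contains the points, hence their mean 0,
   hence their span. *)
move=> u uU T [affT hullT].
have fT v : v \in [tuple f i | i < n] -> T v.
  by move=> /mapP[i _ ->]; apply: hullT => W [_]; apply; exists i.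
apply: (affine_linear affT _ fT) => //.
have -> : 0 = (size [tuple f i | i < n])%:R^-1 *:
    \sum_(u <- [tuple f i | i < n]) u :> V.
  by rewrite big_map big_enum sum0 scaler0.
have sT v : v \in tval [tuple f i | i < n] -> T v by exact: fT.
move: (size_tuple [tuple f i | i < n]) sT.
case: (tval _) => [n0|v s _ sT]; first by rewrite -n0 in n_gt0.
exact: affine_mean.
Qed.

End AffineHull.

(** * Vanishing row sums *)

Section ZeroSum.
Variables (A : choiceType).

(** Each permutation taking [x1] to [p] contributes to exactly one rearrangement of [x2], so the
    total is a signed sum over all such permutations; the transposition of two equal letters of [x1]
    reverses its sign. *)
Lemma youngY_row_sum0 (n : nat) (x1 x2 p : word n A) (g : 'S_n) :
    ~~ injectiveb x1 ->
  \sum_(s : rearr x2) youngY x2 x1 (word_act g (val s)) p = 0.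
Proof.
case/injectivePn=> i [j neq_ij eq_x1].
rewrite /youngY (exchange_big_dep (fun s => word_act s x1 == p)) /=; last first.
  by move=> r s _ /andP[].
rewrite (eq_bigr (fun s : 'S_n => (-1) ^+ s)) => [|s x1p]; last first.
  rewrite (big_pred1 (rearr_act (rearr_self x2) (s * g^-1))) // => r.
  rewrite x1p andbT; apply/eqP/eqP => [eq_r|->] /=.
    by apply: val_inj; rewrite /= word_actM eq_r -word_actM mulgV word_act1.
  by rewrite -word_actM mulgKV.
set S := (X in X = 0).
have fix_x1 : word_act (tperm i j) x1 = x1.
  by apply/ffunP => k; rewrite ffunE tpermV; case: tpermP => // ->.
suff : S = - S by lia.
rewrite {1}/S (reindex_inj (mulgI (tperm i j))) -sumrN /=.
apply: eq_big => [s|s _]; first by rewrite word_actM fix_x1.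
by rewrite odd_permM odd_tperm neq_ij signr_addb mulN1r.
Qed.

(** For fixed [g] the sum over triples is a product of three sums, one per Young character, and one
    of them vanishes. *)
Lemma LR_row_sum0 (l m : nat) (x1 x2 : word l A) (y1 y2 : word m A)
    (w1 w2 : word (l + m) A) p q r :
    [|| ~~ injectiveb x1, ~~ injectiveb y1 | ~~ injectiveb w1] ->
  \sum_(j : rearr x2 * rearr y2 * rearr w2)
     @LR_entry l m A x1 x2 y1 y2 w1 w2 p q r j.1.1 j.1.2 j.2 = 0.
Proof.
move=> noninj; rewrite /LR_entry exchange_big /= big1 // => g _.
rewrite -(pair_bigA _ (fun st u =>
  youngY x2 x1 (word_act g.1 (val st.1)) (val p) *
  youngY y2 y1 (word_act g.2 (val st.2)) (val q) *
  youngY w2 w1 (word_act (block_perm g) (val u)) (val r))) /=.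
under eq_bigr do rewrite -mulr_sumr.
rewrite -mulr_suml -(pair_bigA _ (fun s t =>
  youngY x2 x1 (word_act g.1 (val s)) (val p) *
  youngY y2 y1 (word_act g.2 (val t)) (val q))) /=.
under eq_bigr do rewrite -mulr_sumr.
rewrite -mulr_suml.
by case/or3P: noninj => /youngY_row_sum0 ->; rewrite ?mul0r ?mulr0 ?mul0r.
Qed.

Lemma corresponds_noninj (n : nat) (la : seq nat) (x1 x2 : word n A) k :
  corresponds x1 x2 la -> k \in la -> (1 < k)%N -> ~~ injectiveb x1.
Proof.
move=> x_la la_k k_gt1; have [nth_k _] := x_la (index k la).
rewrite nth_index // in nth_k.
have : k \in letter_counts x1.
  (* Past the end of the list, [k] would be the default 0. *)
  rewrite -nth_k mem_nth // ltnNge; apply: contraL k_gt1 => le_size.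
  by rewrite -nth_k nth_default.
rewrite mem_sort => /mapP[a _ def_k]; apply: contraL k_gt1 => uniq_x1.
by rewrite def_k count_uniq_mem //; case: (_ \in _).
Qed.

End ZeroSum.

Theorem theorem7p6 (R : realType) (A : choiceType) (l m : nat)
    (la mu nu : seq nat)
    (x1 x2 : word l A) (y1 y2 : word m A) (w1 w2 : word (l + m) A)
    (a1 a2 : word l A) (b1 b2 : word m A) (c1 c2 : word (l + m) A)
    (la_part : is_partition l la)
    (mu_part : is_partition m mu)
    (nu_part : is_partition (l + m) nu)
    (* Excludes only la = 1^l, mu = 1^m, nu = 1^(l+m): there the LR matrix has *)
    (* a single column, so the polytope is a point, whereas c is 1.           *)
    (not_all_columns : has (fun k : nat => (1 < k)%N) (la ++ mu ++ nu))
    (hx : complementary_for la x1 x2)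
    (hy : complementary_for mu y1 y2)
    (hw : complementary_for nu w1 w2)
    (* V(la), V(mu), V(nu) may be computed from any complementary pairs. *)
    (ha : complementary_for la a1 a2)
    (hb : complementary_for mu b1 b2)
    (hc : complementary_for nu c1 c2) :
  has_dim (LR_polytope R x1 x2 y1 y2 w1 w2)
          (LR_coef R[i] a1 a2 b1 b2 c1 c2).
Proof.
have defL : LR_mx R x1 x2 y1 y2 w1 w2 = LR_fmx R x1 x2 y1 y2 w1 w2.
  apply/matrixP => i j; rewrite !mxE.
  by case: (enum_val i) => [[p q] r]; case: (enum_val j) => [[s t] u].
have -> : LR_coef R[i] a1 a2 b1 b2 c1 c2 =
    \rank (LR_mx R x1 x2 y1 y2 w1 w2).
  (* Change the pairs over [R[i]] first; the entries are integers, so the rank over [R] is the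
     same. *)
  transitivity (\rank (LR_fmx R[i] x1 x2 y1 y2 w1 w2)).
    rewrite (LR_coef_rank R[i]); apply/eqP; rewrite eqn_leq.
    rewrite (mxrank_LR_fmx_le _ hx hy hw ha hb hc).
    by rewrite (mxrank_LR_fmx_le _ ha hb hc hx hy hw).
  rewrite defL -(mxrank_map (real_complex R)); congr (\rank _).
  by apply/matrixP => i j; rewrite !mxE rmorph_int.
rewrite -dim_col_span; apply: has_dim_convex_hull.
  by apply/card_gt0P; exists (rearr_self x2, rearr_self y2, rearr_self w2).
apply/colP => i; rewrite summxE mxE.
under eq_bigr do rewrite defL !mxE.
rewrite -rmorph_sum /= -(big_enum_val (fun j : rearr x2 * rearr y2 * rearr w2 =>
  LR_entry (enum_val i).1.1 (enum_val i).1.2 (enum_val i).2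
    j.1.1 j.1.2 j.2)) /=.
rewrite LR_row_sum0 //; case/hasP: not_all_columns => k.
rewrite !mem_cat => /or3P[] in_k k_gt1; apply/or3P.
- by apply: Or31; case: hx => _ /corresponds_noninj/(_ in_k k_gt1).
- by apply: Or32; case: hy => _ /corresponds_noninj/(_ in_k k_gt1).
- by apply: Or33; case: hw => _ /corresponds_noninj/(_ in_k k_gt1).
Qed.
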